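(* Let $f:\mathbb{N}\to\mathbb{N}_{\ge 0}$ be an arithmetic function with $f(n)<n$ for all $n$ and $f(n)=o(n)$ as $n\to\infty$. Then for Lebesgue-almost every irrational $\alpha\in(0,1)$, \[ \lim_{n\to\infty} S(\alpha,n,n-f(n))^{1/(n-f(n))} = K_0, \] where $K_0=\prod_{r=1}^\infty\left(1+\frac{1}{r(r+2)}\right)^{\log_2 r}$ is Khinchin's constant.
   Context: Every irrational $\alpha\in(0,1)$ has a unique continued fraction expansion $\alpha = 1/(a_1(\alpha)+1/(a_2(\alpha)+\cdots))$ with digits $a_i(\alpha)\in\mathbb{N}_{\ge1}$. For $1\le k\le n$ integers, \[ S(\alpha,n,k) := \binom{n}{k}^{-1}\sum_{1\le i_1<\cdots<i_k\le n} a_{i_1}(\alpha)\cdots a_{i_k}(\alpha). \] *)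

(* Defs.v *)
From HB Require Import structures.
From mathcomp Require Import all_boot all_order all_algebra.
From mathcomp Require Import all_classical all_reals all_analysis.
Set Implicit Arguments. Unset Strict Implicit. Unset Printing Implicit Defensive.
Import Order.TTheory GRing.Theory Num.Theory.
Import numFieldNormedType.Exports.
Local Open Scope ring_scope.

Section Defs.
Variable R : realType.

Definition gauss (x : R) : R := x^-1 - (Num.floor (x^-1))%:~R.

Definition cf_digit (i : nat) (alpha : R) : nat :=
  Num.truncn ((iter i.-1 gauss alpha)^-1).

(* S(alpha,n,k) = binom(n,k)^{-1} * sum_{1<=i_1<...<i_k<=n} a_{i_1}...a_{i_k};
   index sets {i_1,...,i_k} are k-subsets of 'I_n, shifted by one. *)
Definition S_cf (alpha : R) (n k : nat) : R :=
  ('C(n, k)%:R)^-1 *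
  \sum_(I : {set 'I_n} | #|I| == k) \prod_(i in I) (cf_digit (val i).+1 alpha)%:R.

Definition khinchin_K0 : R :=
  limn (fun N : nat => \prod_(1 <= r < N.+1)
          ((1 + (r%:R * (r%:R + 2))^-1) `^ (ln (r%:R : R) / ln 2))).
End Defs.

(* Main.v *)
(** Two facts combine.

    Deterministically, with [k = n - f n] and digits at least [1], every
    [k]-subset product is at most the product of all [n] digits, while
    AM-GM over the [k]-subsets bounds their mean below by the [k/n]-th power of
    that product.  As [k / n] tends to [1], both bounds on [S^(1/k)] have the
    limit of the geometric mean of the digits, so Khinchin's theorem on that
    mean suffices.

    For Khinchin's theorem, start from Lebesgue measure and let
    [s = q_(n-1) / q_n].  Given the first [n] digits, the next one is [k] with
    probability [w_k(s) = (1 + s) / ((k + s) (k + 1 + s))], and [s] moves to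
    [1 / (k + s)].  The transition operator [P h s = sum_k w_k(s) h(1/(k+s))]
    contracts Lipschitz constants on [[0, 1]] by [17/20] and preserves the
    integral against [ds / (1 + s)]; hence the iterates [P^M G] of
    [G s = sum_k w_k(s) ln k] converge uniformly to [ln K_0].  With
    [u = sum_(m < M) P^m G] one has [G + P u - u = P^M G], so the sum of the
    [ln a_i - ln K_0] is, up to a bounded term and a small drift, a martingale
    with increments of bounded variance.  Chebyshev's inequality and the
    Borel-Cantelli lemma along [n = j^2], then monotonicity in [n], give the
    almost sure limit. *)

Require Import Defs.
From HB Require Import structures.
From mathcomp Require Import all_boot all_order all_algebra.
From mathcomp Require Import all_classical all_reals all_analysis.
From mathcomp Require Import ring lra.
Import Order.TTheory GRing.Theory Num.Theory.
Import numFieldNormedType.Exports.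
Local Open Scope ring_scope.
Local Open Scope classical_set_scope.

Set Implicit Arguments.
Unset Strict Implicit.
Unset Printing Implicit Defensive.

(** * The transition probabilities of the digits *)

(** A telescoping majorant [g] gives convergence and an explicit bound together; most series
    estimates below reduce to finding [g]. *)
Lemma telescoping_series_bound (R : realType) (u g : R^nat) :
  (forall k, `|u k| <= g k - g k.+1) -> (forall k, 0 <= g k) ->
  cvgn (series u) /\ `|limn (series u)| <= g 0%N.
Proof.
move=> ug g0.
have bnd n : series (fun k => `|u k|) n <= g 0%N.
  suff : series (fun k => `|u k|) n <= g 0%N - g n by move/le_trans; apply; rewrite gerBl.
  elim: n => [|n IH]; first by rewrite /series /= big_geq// subrr.
  by rewrite seriesSr; have := lerD IH (ug n); rewrite addrA subrK.
have cn : cvgn [normed series u].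
  apply: nondecreasing_is_cvgn; first by apply: nondecreasing_series => *; exact: normr_ge0.
  by exists (g 0%N) => _ [n _ <-]; exact: bnd.
split; first exact: normed_cvg.
apply: le_trans (lim_series_norm cn) _.
by apply: limr_le => //; apply: nearW => n; exact: bnd.
Qed.

Section transfer.
Variable R : realType.
Implicit Types (s x y : R) (F : nat -> R) (h : R -> R).

(* Index [k] stands for the digit [k.+1], here and in [log_digit], [increment]. *)
Definition weight s (k : nat) : R := (1 + s) / ((k.+1%:R + s) * (k.+2%:R + s)).

Definition expect s F : R := limn (series (fun k => weight s k * F k)).

Lemma natS_gt0 s k : 0 <= s -> 0 < k.+1%:R + s.
Proof. by move=> s0; rewrite ltr_pwDl. Qed.

Lemma natS_neq0 s k : 0 <= s -> k.+1%:R + s != 0.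
Proof. by move=> s0; rewrite gt_eqF// natS_gt0. Qed.

Lemma weight_ge0 s k : 0 <= s -> 0 <= weight s k.
Proof.
by move=> s0; rewrite /weight divr_ge0 ?addr_ge0// mulr_ge0// ltW// natS_gt0.
Qed.

Lemma weight_le s k : 0 <= s <= 1 -> weight s k <= 2 / (k.+1%:R * k.+2%:R).
Proof.
case/andP=> s0 s1; rewrite /weight ler_pM ?addr_ge0//.
- by rewrite invr_ge0 mulr_ge0// ltW// natS_gt0.
- lra.
- by rewrite lef_pV2 ?posrE ?mulr_gt0 ?natS_gt0// ler_pM// lerDl.
Qed.

(** The weights telescope: [weight s k] is [(1 + s)] times the difference of [1 / (k + 1 + s)] and
    [1 / (k + 2 + s)]. The closed form later acts as a distribution function. *)
Lemma series_weight s n : 0 <= s -> series (weight s) n = n%:R / (n.+1%:R + s).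
Proof.
move=> s0; elim: n => [|n IH]; first by rewrite /series /= big_geq// mul0r.
rewrite seriesSr IH /weight.
have h1 := natS_neq0 n s0; have h2 := natS_neq0 n.+1 s0.
move: h1 h2; rewrite -!natr1 => h1 h2; field.
by rewrite h1 h2.
Qed.

(** The weights decay like [1 / k^2], so this growth keeps [expect] absolutely convergent, with room
    for the logarithm and its square. *)
Definition sqrt_growth (B : R) F := forall k, `|F k| <= B * Num.sqrt k.+1%:R.

Lemma sqrt_telescoping k : Num.sqrt k.+1%:R / (k.+1%:R * k.+2%:R) <=
  2 * (Num.sqrt k.+1%:R)^-1 - 2 * (Num.sqrt k.+2%:R)^-1 :> R.
Proof.
set a := Num.sqrt k.+1%:R; set b := Num.sqrt k.+2%:R.
have a0 : 0 < a by rewrite sqrtr_gt0.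
have b0 : 0 < b by rewrite sqrtr_gt0.
have aE : k.+1%:R = a ^+ 2 by rewrite sqr_sqrtr.
have bE : k.+2%:R = b ^+ 2 by rewrite sqr_sqrtr.
have ab : b ^+ 2 = a ^+ 2 + 1 by rewrite -aE -bE -natr1.
have leab : a <= b by rewrite ler_sqrt// ler_nat.
rewrite aE bE -subr_ge0.
have -> : 2 / a - 2 / b - a / (a ^+ 2 * b ^+ 2) = (2 * b * (b - a) - 1) / (a * b ^+ 2).
  by field; rewrite !gt_eqF.
rewrite divr_ge0// ?mulr_ge0// ?exprn_ge0 ?ltW//.
(* Since [b ^+ 2 - a ^+ 2 = 1], the numerator equals [(b - a) ^+ 2]. *)
nra.
Qed.

Lemma expect_telescoping s B F : 0 <= s <= 1 -> sqrt_growth B F -> forall k,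
  `|weight s k * F k| <= 4 * B * (Num.sqrt k.+1%:R)^-1 - 4 * B * (Num.sqrt k.+2%:R)^-1.
Proof.
move=> s01 FB k; have /andP[s0 _] := s01.
have B0 : 0 <= B by have := le_trans (normr_ge0 _) (FB 0%N); rewrite sqrtr1 mulr1.
rewrite normrM (ger0_norm (weight_ge0 _ s0)).
apply: (@le_trans _ _ (2 / (k.+1%:R * k.+2%:R) * (B * Num.sqrt k.+1%:R))).
  by rewrite ler_pM ?weight_ge0// weight_le.
have := sqrt_telescoping k.
move/(ler_wpM2l (mulr_ge0 (ler0n R 2) B0)).
set a := Num.sqrt _ / _ => h.
have -> : 2 / (k.+1%:R * k.+2%:R) * (B * Num.sqrt k.+1%:R) = 2 * B * a.
  by rewrite /a; ring.
apply: le_trans h _; lra.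
Qed.

Lemma expect_cvg s B F : 0 <= s <= 1 -> sqrt_growth B F ->
  series (fun k => weight s k * F k) @ \oo --> expect s F.
Proof.
move=> s01 FB.
have B0 : 0 <= B by have := le_trans (normr_ge0 _) (FB 0%N); rewrite sqrtr1 mulr1.
have [|//] := telescoping_series_bound (expect_telescoping s01 FB).
by move=> k; rewrite mulr_ge0// ?mulr_ge0// invr_ge0 sqrtr_ge0.
Qed.

Lemma expect_le s B F : 0 <= s <= 1 -> sqrt_growth B F -> `|expect s F| <= 4 * B.
Proof.
move=> s01 FB.
have B0 : 0 <= B by have := le_trans (normr_ge0 _) (FB 0%N); rewrite sqrtr1 mulr1.
have [|_] := telescoping_series_bound (expect_telescoping s01 FB).
  by move=> k; rewrite mulr_ge0// ?mulr_ge0// invr_ge0 sqrtr_ge0.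
by rewrite sqrtr1 invr1 mulr1.
Qed.

Lemma expectP s F v :
  series (fun k => weight s k * F k) @ \oo --> v -> expect s F = v.
Proof. by move=> h; apply/cvg_lim. Qed.

Lemma cvg_harmonic_shift (s : R) : 0 <= s -> (fun n => (n.+1%:R + s)^-1) @ \oo --> (0 : R).
Proof.
move=> s0; apply: (squeeze_cvgr _ (cvg_cst 0) (@cvg_harmonic R)).
apply: nearW => n /=; rewrite invr_ge0 ltW ?natS_gt0//=.
by rewrite lef_pV2 ?posrE ?natS_gt0// lerDl.
Qed.

Lemma weight_cvg s : 0 <= s -> series (weight s) @ \oo --> (1 : R).
Proof.
move=> s0.
have -> : series (weight s) = (fun n => 1 - (1 + s) * (n.+1%:R + s)^-1).
  apply/funext => n; rewrite series_weight//.
  by have := natS_neq0 n s0; rewrite -natr1 => h; field.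
suff : (fun n => 1 - (1 + s) * (n.+1%:R + s)^-1) @ \oo --> (1 - (1 + s) * 0 : R).
  by rewrite mulr0 subr0.
by apply: cvgB; [exact: cvg_cst | apply: cvgMr; exact: cvg_harmonic_shift].
Qed.

Lemma expect_cst s (c : R) : 0 <= s -> expect s (fun=> c) = c.
Proof.
move=> s0; apply: expectP.
have -> : series (fun k => weight s k * c) = (fun n => series (weight s) n * c).
  by apply/funext => n; rewrite /series /= mulr_suml.
by rewrite -[X in _ --> X]mul1r; apply: cvgMl; exact: weight_cvg.
Qed.

Lemma expectD s B1 B2 F1 F2 : 0 <= s <= 1 -> sqrt_growth B1 F1 -> sqrt_growth B2 F2 ->
  expect s (fun k => F1 k + F2 k) = expect s F1 + expect s F2.
Proof.
move=> s01 g1 g2; apply: expectP.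
have -> : series (fun k => weight s k * (F1 k + F2 k)) =
   series (fun k => weight s k * F1 k) + series (fun k => weight s k * F2 k).
  by rewrite -seriesD; congr series; apply/funext => k; rewrite mulrDr.
by apply: cvgD; [exact: (expect_cvg s01 g1) | exact: (expect_cvg s01 g2)].
Qed.

Lemma expectZ s B F (c : R) : 0 <= s <= 1 -> sqrt_growth B F ->
  expect s (fun k => c * F k) = c * expect s F.
Proof.
move=> s01 g; apply: expectP.
have -> : series (fun k => weight s k * (c * F k)) =
   (fun n => c * series (fun k => weight s k * F k) n).
  by apply/funext => n; rewrite /series /= mulr_sumr; apply: eq_bigr => k _; rewrite mulrCA.
by apply: cvgMr; exact: (expect_cvg s01 g).
Qed.

Lemma sqrt_growthD B1 B2 F1 F2 : sqrt_growth B1 F1 -> sqrt_growth B2 F2 ->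
  sqrt_growth (B1 + B2) (fun k => F1 k + F2 k).
Proof.
by move=> g1 g2 k; rewrite mulrDl (le_trans (ler_normD _ _))// lerD.
Qed.

Lemma sqrt_growthZ B F c : sqrt_growth B F -> sqrt_growth (`|c| * B) (fun k => c * F k).
Proof. by move=> g k; rewrite normrM -mulrA ler_wpM2l. Qed.

Lemma sqrt_growth_bounded B F : (forall k, `|F k| <= B) -> sqrt_growth B F.
Proof.
move=> FB k; have B0 := le_trans (normr_ge0 _) (FB k).
rewrite (le_trans (FB k))// ler_peMr// -[leLHS](@sqrtr1 R) ler_sqrt// ler1n//.
Qed.

Definition log_digit (k : nat) : R := ln k.+1%:R.

(** This is [ln r < r] at the fourth root [r] of [k.+1]; a fourth root, because the square of the
    logarithm must have square-root growth too. *)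
Lemma log_digit_le k : 0 <= log_digit k <= 4 * Num.sqrt (Num.sqrt k.+1%:R).
Proof.
rewrite ln_ge0 ?ler1n//=.
set r := Num.sqrt _.
have r0 : 0 < r by rewrite !sqrtr_gt0.
have -> : log_digit k = ln r *+ 4.
  rewrite -lnXn// /log_digit; congr ln.
  by rewrite (_ : 4 = 2 * 2)%N// exprM !sqr_sqrtr// sqrtr_ge0.
by rewrite -[leLHS]mulr_natl ler_wpM2l// ltW// ln_sublinear.
Qed.

Lemma log_digit_growth : sqrt_growth 4 log_digit.
Proof.
move=> k; have /andP[l0 l1] := log_digit_le k.
rewrite ger0_norm// (le_trans l1)// ler_wpM2l//.
rewrite ler_sqrt// -[leLHS]mulr1.
have : 1 <= Num.sqrt k.+1%:R :> R by rewrite -[leLHS](@sqrtr1 R) ler_sqrt// ler1n.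
have := @sqr_sqrtr R k.+1%:R (ler0n _ _); nra.
Qed.

(** [B] is chosen before [F], so that one variance bound serves the increments at every [s]. *)
Lemma sqr_log_digit_growth (b : R) : exists B, forall F,
  (forall k, `|F k| <= log_digit k + b) -> sqrt_growth B (fun k => F k ^+ 2).
Proof.
exists ((4 + b) ^+ 2) => F Fb k.
have /andP[l0 l1] := log_digit_le k.
set r := Num.sqrt (Num.sqrt k.+1%:R) in l1 *.
have rE : r ^+ 2 = Num.sqrt k.+1%:R by rewrite sqr_sqrtr// sqrtr_ge0.
have r1 : 1 <= r.
  by rewrite -[leLHS](@sqrtr1 R) ler_sqrt// -[leLHS](@sqrtr1 R) ler_sqrt// ler1n.
have F0 := normr_ge0 (F k).
have b0 : 0 <= b by have := le_trans (normr_ge0 _) (Fb 0%N); rewrite /log_digit ln1 add0r.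
rewrite normrX -rE -exprMn ler_sqr ?nnegrE ?mulr_ge0 ?addr_ge0 ?(le_trans ler01 r1)//.
have := Fb k; nra.
Qed.

End transfer.

(** * Contraction of Lipschitz constants *)

Section contraction.
Variable R : realType.
Implicit Types (s x y : R) (F : nat -> R) (h : R -> R).

Lemma expectB s B1 B2 F1 F2 : 0 <= s <= 1 -> sqrt_growth B1 F1 -> sqrt_growth B2 F2 ->
  expect s (fun k => F1 k - F2 k) = expect s F1 - expect s F2.
Proof.
move=> s01 g1 g2; have g2' := sqrt_growthZ (-1) g2.
rewrite (_ : (fun k => _) = fun k => F1 k + -1 * F2 k); last first.
  by apply/funext => k; rewrite mulN1r.
by rewrite (expectD s01 g1 g2') (expectZ _ s01 g2) mulN1r.
Qed.

Lemma expect_norm_le s F (g : nat -> R) :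
  (forall k, `|weight s k * F k| <= g k - g k.+1) -> (forall k, 0 <= g k) ->
  `|expect s F| <= g 0%N.
Proof. by move=> wg g0; have [] := telescoping_series_bound wg g0. Qed.

Let wcdf s k := series (weight s) k.

Lemma wcdf_lip x y k : 0 <= x -> 0 <= y ->
  `|wcdf x k - wcdf y k| <= k%:R / k.+1%:R ^+ 2 * `|x - y|.
Proof.
move=> x0 y0; rewrite /wcdf !series_weight//.
have hx := natS_gt0 k x0; have hy := natS_gt0 k y0.
have -> : k%:R / (k.+1%:R + x) - k%:R / (k.+1%:R + y) =
   k%:R / ((k.+1%:R + x) * (k.+1%:R + y)) * (y - x).
  by move: k.+1%:R hx hy => a hx hy; field; rewrite !gt_eqF.
rewrite normrM (distrC y) ler_wpM2r// ger0_norm; last first.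
  by rewrite divr_ge0// mulr_ge0// ltW.
rewrite ler_wpM2l// lef_pV2 ?posrE ?mulr_gt0//.
by rewrite expr2 ler_pM// lerDl.
Qed.

Lemma summation_by_parts x y F n :
  series (fun k => weight x k * F k) n - series (fun k => weight y k * F k) n =
  (wcdf x n - wcdf y n) * F n +
  \sum_(0 <= k < n) (wcdf x k.+1 - wcdf y k.+1) * (F k - F k.+1).
Proof.
elim: n => [|n IH].
  by rewrite /wcdf /series /= !big_geq// !subrr mul0r addr0.
rewrite big_nat_recr//= !seriesSr.
have -> : series (fun k => weight x k * F k) n + weight x n * F n -
  (series (fun k => weight y k * F k) n + weight y n * F n) =
  (series (fun k => weight x k * F k) n - series (fun k => weight y k * F k) n) +
  (weight x n - weight y n) * F n by ring.
rewrite IH /wcdf !seriesSr; ring.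
Qed.

Lemma cvg_inv_sqrt : (fun n => (Num.sqrt n.+1%:R : R)^-1) @ \oo --> (0 : R).
Proof.
have -> : (fun n => (Num.sqrt n.+1%:R : R)^-1) = (fun n => Num.sqrt (@harmonic R n)).
  by apply/funext => n; rewrite /harmonic sqrtrV.
rewrite -(@sqrtr0 R); apply: continuous_cvg; [exact: sqrt_continuous | exact: cvg_harmonic].
Qed.

(** Summation by parts moves the dependence on [x] and [y] into the distribution functions, which
    differ by at most [k / (k + 1)^2] times [|x - y|]. Only consecutive differences of [F] remain;
    the boundary term is [O(n^(-1/2))]. *)
Lemma expect_lip x y B F (b g : nat -> R) : 0 <= x <= 1 -> 0 <= y <= 1 ->
  sqrt_growth B F -> (forall k, `|F k - F k.+1| <= b k) ->
  (forall k, k.+1%:R / k.+2%:R ^+ 2 * b k <= g k - g k.+1) -> (forall k, 0 <= g k) ->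
  `|expect x F - expect y F| <= g 0%N * `|x - y|.
Proof.
move=> x01 y01 FB Fb bg g0; have /andP[x0 _] := x01; have /andP[y0 _] := y01.
have B0 : 0 <= B by have := le_trans (normr_ge0 _) (FB 0%N); rewrite sqrtr1 mulr1.
have cl : (fun n => `|series (fun k => weight x k * F k) n -
    series (fun k => weight y k * F k) n|) @ \oo --> `|expect x F - expect y F|.
  by apply: cvg_norm; apply: cvgB; exact: expect_cvg FB.
have cr : (fun n => g 0%N * `|x - y| + B * `|x - y| * (Num.sqrt n.+1%:R)^-1)
    @ \oo --> g 0%N * `|x - y|.
  rewrite -[X in _ --> X]addr0 -[X in _ --> _ + X](mulr0 (B * `|x - y|)).
  by apply: cvgD; [exact: cvg_cst | apply: cvgMr; exact: cvg_inv_sqrt].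
apply: (ler_cvg_to cl cr); apply: nearW => n.
rewrite summation_by_parts (le_trans (ler_normD _ _))// addrC lerD//.
  apply: (@le_trans _ _ ((g 0%N - g n) * `|x - y|)); last by rewrite ler_wpM2r// gerBl.
  rewrite (le_trans (ler_norm_sum _ _ _))//.
  elim: n => [|n IH]; first by rewrite big_geq// subrr mul0r.
  rewrite big_nat_recr//=.
  have -> : g 0%N - g n.+1 = (g 0%N - g n) + (g n - g n.+1) by ring.
  rewrite [leRHS]mulrDl lerD// normrM.
  apply: (@le_trans _ _ (n.+1%:R / n.+2%:R ^+ 2 * `|x - y| * b n)).
    by rewrite ler_pM// wcdf_lip.
  by rewrite mulrAC ler_wpM2r.
rewrite normrM.
apply: (@le_trans _ _ (n%:R / n.+1%:R ^+ 2 * `|x - y| * (B * Num.sqrt n.+1%:R))).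
  by rewrite ler_pM// wcdf_lip.
have s0 : 0 < Num.sqrt n.+1%:R :> R by rewrite sqrtr_gt0.
have sE : n.+1%:R = Num.sqrt n.+1%:R ^+ 2 :> R by rewrite sqr_sqrtr.
set a := Num.sqrt n.+1%:R in s0 sE *.
have -> : n%:R / n.+1%:R ^+ 2 * `|x - y| * (B * a) = (n%:R / a ^+ 2) * (B * `|x - y| * a^-1).
  by rewrite sE; field; rewrite gt_eqF.
rewrite ler_piMl ?mulr_ge0 ?invr_ge0 ?(ltW s0)//.
by rewrite -sE ler_pdivrMr// mul1r ler_nat.
Qed.

Definition mean_log s := expect s (@log_digit R).

Lemma mean_log_lip x y : 0 <= x <= 1 -> 0 <= y <= 1 ->
  `|mean_log x - mean_log y| <= `|x - y|.
Proof.
move=> x01 y01; rewrite -[leRHS]mul1r -[X in _ <= X * _]invr1.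
(* With [a = k.+1], [b] comes from [ln (1 + 1/a) <= 1/a]; the terms to be summed are then
   [1 / (a + 1)^2], below [1/a - 1/(a + 1)]. *)
apply: (expect_lip (b := fun k => k.+1%:R^-1) (g := fun k => k.+1%:R^-1)) => //.
- exact: log_digit_growth.
- move=> k; rewrite distrC /log_digit -ln_div ?posrE//.
  have -> : k.+2%:R / k.+1%:R = 1 + k.+1%:R^-1 :> R by rewrite -[k.+2%:R]natr1; field.
  rewrite ger0_norm ?ln_ge0 ?lerDl ?invr_ge0//.
  by rewrite le_ln1Dx// (lt_le_trans (ltrN10 _))// invr_ge0.
- move=> k; rewrite -[k.+2%:R]natr1.
  set a : R := k.+1%:R; have a0 : 0 < a by [].
  rewrite -subr_ge0.
  have -> : a^-1 - (a + 1)^-1 - a / (a + 1) ^+ 2 * a^-1 = (a * (a + 1) ^+ 2)^-1.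
    by field; rewrite !gt_eqF// addr_gt0.
  by rewrite invr_ge0 mulr_ge0 ?exprn_ge0// ?addr_ge0// ltW.
Qed.

Definition transfer h s := expect s (fun k => h ((k.+1%:R + s)^-1)).

Definition unit_lip (L : R) h := forall x y, 0 <= x <= 1 -> 0 <= y <= 1 ->
  `|h x - h y| <= L * `|x - y|.

Lemma inv_natS_itv s k : 0 <= s -> 0 <= (k.+1%:R + s)^-1 <= 1.
Proof.
move=> s0; have h := natS_gt0 k s0.
rewrite invr_ge0 ltW//= invf_le1//.
by rewrite -[leLHS]addr0 lerD// ler1n.
Qed.

Lemma unit_lip_ge0 L h : unit_lip L h -> 0 <= L.
Proof.
move=> hL; have := hL 0 1; rewrite !lexx ler01 => /(_ isT isT).
by rewrite sub0r normrN1 mulr1; apply: le_trans.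
Qed.

Lemma unit_lip_bounded L h : unit_lip L h -> forall x, 0 <= x <= 1 -> `|h x| <= `|h 0| + L.
Proof.
move=> hL x x01; rewrite -[h x](subrK (h 0)) addrC (le_trans (ler_normD _ _))// lerD//.
rewrite (le_trans (hL x 0 x01 _)) ?lexx ?ler01//.
by case/andP: x01 => x0 x1; rewrite subr0 ger0_norm// ler_piMr// (unit_lip_ge0 hL).
Qed.

Lemma transfer_growth B h s : 0 <= s -> (forall x, 0 <= x <= 1 -> `|h x| <= B) ->
  sqrt_growth B (fun k => h ((k.+1%:R + s)^-1)).
Proof. by move=> s0 hB; apply: sqrt_growth_bounded => k; apply/hB/inv_natS_itv. Qed.

Lemma inv_lip (a x y : R) : 0 < a -> 0 <= x -> 0 <= y ->
  `|(a + x)^-1 - (a + y)^-1| <= a^-1 ^+ 2 * `|x - y|.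
Proof.
move=> a0 x0 y0; have ax : 0 < a + x by rewrite ltr_pwDl.
have ay : 0 < a + y by rewrite ltr_pwDl.
have -> : (a + x)^-1 - (a + y)^-1 = (a + x)^-1 * (a + y)^-1 * (y - x).
  by field; rewrite !gt_eqF.
have ix : 0 <= (a + x)^-1 by rewrite invr_ge0 ltW.
have iy : 0 <= (a + y)^-1 by rewrite invr_ge0 ltW.
rewrite normrM (distrC y) ler_wpM2r// ger0_norm ?mulr_ge0//.
by rewrite expr2 ler_pM// lef_pV2 ?posrE// lerDl.
Qed.

(* Moving the nodes [1 / (k + x)] costs a factor [3/5], changing the weights
   (summed by parts) a factor [1/4]. *)
Lemma transfer_contract L h : unit_lip L h -> unit_lip (17 / 20 * L) (transfer h).
Proof.
move=> hL x y x01 y01; have /andP[x0 x1] := x01; have /andP[y0 y1] := y01.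
have L0 := unit_lip_ge0 hL.
have grx := transfer_growth x0 (unit_lip_bounded hL).
have gry := transfer_growth y0 (unit_lip_bounded hL).
set Fx := (fun k => h _) in grx; set Fy := (fun k => h _) in gry.
rewrite -/(transfer h x) /transfer -/Fx -/Fy.
have -> : expect x Fx - expect y Fy =
  expect x (fun k => Fx k - Fy k) + (expect x Fy - expect y Fy).
  by rewrite (expectB x01 grx gry); ring.
have -> : 17 / 20 * L * `|x - y| = 3 / 5 * L * `|x - y| + 1 / 4 * L * `|x - y|.
  by field.
rewrite (le_trans (ler_normD _ _))// lerD//.
  have D0 : 0 <= L * `|x - y| by rewrite mulr_ge0.
  (* With [D = L |x - y|], term [k] is at most [2 D / ((k + 1)^2 (k + 2)^2)]. The factor [2/5] is
     the least one that telescopes all terms with [k >= 1]; the term [D / 2] at [k = 0] then forces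
     [3/5], as [1/2 + 2/5 * 1/4 = 3/5]. *)
  pose g k : R := if k is 0 then 3 / 5 * (L * `|x - y|)
    else 2 / 5 * (L * `|x - y|) * (k.+1%:R^-1 ^+ 2).
  have -> : 3 / 5 * L * `|x - y| = g 0%N by rewrite /g -mulrA.
  apply: (@expect_norm_le x _ g); last first.
    by case=> [|k] /=; rewrite mulr_ge0// ?mulr_ge0// exprn_ge0// invr_ge0.
  move=> k; rewrite normrM (ger0_norm (weight_ge0 _ x0)).
  have kx : 0 < k.+1%:R :> R by [].
  have hk : `|Fx k - Fy k| <= L * `|x - y| * (k.+1%:R^-1 ^+ 2).
    rewrite (le_trans (hL _ _ _ _)) ?inv_natS_itv// -mulrA ler_wpM2l// mulrC.
    by rewrite [leRHS]mulrC mulrC inv_lip.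
  apply: (@le_trans _ _ (2 / k.+2%:R ^+ 2 * (L * `|x - y| * (k.+1%:R^-1 ^+ 2)))).
    rewrite ler_pM// ?weight_ge0// /weight.
    have k2 : k.+2%:R = k.+1%:R + 1 :> R by rewrite -[LHS]natr1.
    have d0 : 0 <= k%:R :> R by [].
    rewrite k2 -natr1; set d : R := k%:R in d0 *.
    rewrite -subr_ge0.
    have -> : 2 / (d + 1 + 1) ^+ 2 - (1 + x) / ((d + 1 + x) * (d + 1 + 1 + x)) =
      (2 * ((d + 1 + x) * (d + 1 + 1 + x)) - (1 + x) * (d + 1 + 1) ^+ 2) /
      ((d + 1 + 1) ^+ 2 * ((d + 1 + x) * (d + 1 + 1 + x))).
      by field; apply/and3P; split; rewrite gt_eqF//; lra.
    rewrite divr_ge0//; last first.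
      by rewrite !mulr_ge0// ?exprn_ge0//; lra.
    have : 0 <= d * (1 - x) by rewrite mulr_ge0// subr_ge0.
    nra.
  case: k {kx hk} => [|k] /=.
    rewrite invr1 expr1n mulr1; set D := L * _ in D0 *.
    by rewrite le_eqVlt; apply/orP; left; apply/eqP; field.
  have d0 : 0 <= k%:R :> R by [].
  rewrite -[k.+3%:R]natr1 -[k.+2%:R]natr1 -[k.+1%:R]natr1; set d : R := k%:R in d0 *.
  set D := L * _ in D0 *; rewrite -subr_ge0.
  have -> : 2 / 5 * D * (d + 1 + 1)^-1 ^+ 2 - 2 / 5 * D * (d + 1 + 1 + 1)^-1 ^+ 2 -
    2 / (d + 1 + 1 + 1) ^+ 2 * (D * (d + 1 + 1)^-1 ^+ 2) =
    D * (4 / 5 * d) / ((d + 1 + 1) ^+ 2 * (d + 1 + 1 + 1) ^+ 2).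
    by field; apply/andP; split; rewrite gt_eqF//; lra.
  by rewrite divr_ge0// ?mulr_ge0// ?exprn_ge0//; lra.
(* The differences of [g] are [L / ((k + 1) (k + 2) (k + 3))], which dominate the required
   [L / (k + 2)^3]. *)
pose g k : R := 1 / 2 * L / (k.+1%:R * k.+2%:R).
have -> : 1 / 4 * L = g 0%N by rewrite /g; field.
apply: (expect_lip (b := fun k => L / (k.+1%:R * k.+2%:R)) _ _ gry) => //.
- move=> k; rewrite (le_trans (hL _ _ _ _)) ?inv_natS_itv// ler_wpM2l//.
  have ky := natS_gt0 k y0; have ky' := natS_gt0 k.+1 y0.
  have -> : (k.+1%:R + y)^-1 - (k.+2%:R + y)^-1 = ((k.+1%:R + y) * (k.+2%:R + y))^-1.
    move: ky ky'; rewrite -[k.+2%:R]natr1; move: k.+1%:R => a ky ky'.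
    by field; rewrite !gt_eqF.
  rewrite ger0_norm; last by rewrite invr_ge0 mulr_ge0// ltW.
  by rewrite lef_pV2 ?posrE ?mulr_gt0// ler_pM// lerDl.
- move=> k; rewrite /g -[k.+3%:R]natr1 -[k.+2%:R]natr1.
  set a : R := k.+1%:R; have a0 : 0 < a by [].
  rewrite -subr_ge0.
  have -> : 1 / 2 * L / (a * (a + 1)) - 1 / 2 * L / ((a + 1) * (a + 1 + 1)) -
     a / (a + 1) ^+ 2 * (L / (a * (a + 1))) = L / (a * (a + 1) ^+ 3 * (a + 1 + 1)).
    by field; apply/and3P; split; rewrite gt_eqF//; lra.
  by rewrite divr_ge0// !mulr_ge0// ?exprn_ge0//; lra.
- by move=> k; rewrite /g divr_ge0 ?mulr_ge0.
Qed.

Lemma transferD L1 L2 h1 h2 s : 0 <= s <= 1 -> unit_lip L1 h1 -> unit_lip L2 h2 ->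
  transfer (fun x => h1 x + h2 x) s = transfer h1 s + transfer h2 s.
Proof.
move=> s01 /unit_lip_bounded b1 /unit_lip_bounded b2; have /andP[s0 _] := s01.
exact: (expectD s01 (transfer_growth s0 b1) (transfer_growth s0 b2)).
Qed.

Lemma iter_transfer_lip M : unit_lip ((17 / 20) ^+ M) (iter M transfer mean_log).
Proof.
elim: M => [|M IH]; first by move=> x y x01 y01; rewrite mul1r mean_log_lip.
by rewrite exprS; exact: transfer_contract.
Qed.

Lemma poisson_equation M : exists L u, unit_lip L u /\ forall s, 0 <= s <= 1 ->
  mean_log s + transfer u s - u s = iter M transfer mean_log s.
Proof.
elim: M => [|M [L [u [uL uE]]]].
  exists 0, (fun=> 0); split=> [x y _ _|s /andP[s0 _]]; first by rewrite subrr normr0 mul0r.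
  by rewrite /transfer expect_cst// addr0 subr0.
have lM := iter_transfer_lip M.
(* [transfer] sends the added iterate to the next one, while subtracting it cancels the old
   right-hand side. *)
exists (L + (17 / 20) ^+ M), (fun x => u x + iter M transfer mean_log x); split.
  move=> x y x01 y01; rewrite opprD addrACA mulrDl (le_trans (ler_normD _ _))//.
  by rewrite lerD ?uL ?lM.
move=> s s01; rewrite (transferD s01 uL lM) -[RHS]/(transfer (iter M transfer mean_log) s).
by have := uE s s01; lra.
Qed.

End contraction.

(** * The invariant integral *)

Section invariant_functional.
Variable R : realType.
Implicit Types (s x y : R) (g h H : R -> R).

(** The derivative is two-sided even at [0] and [1]: composing [g] with the projection onto [[0, 1]]
    extends it continuously to the line, and the fundamental theorem of calculus is applied on
    [[-1, 3]]. *)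
Lemma unit_lip_primitive L g : unit_lip L g ->
  exists H : R -> R, forall x, 0 <= x <= 1 -> is_derive x 1 H (g x).
Proof.
move=> gL; have L0 := unit_lip_ge0 gL.
pose clamp x : R := Num.min 1 (Num.max 0 x).
have clamp01 x : 0 <= clamp x <= 1.
  by rewrite /clamp; case: (leP 0 x) => ?; case: (leP 1 _) => ?; apply/andP; split; lra.
have clampid x : 0 <= x <= 1 -> clamp x = x.
  by case/andP=> ? ?; rewrite /clamp; case: (leP 0 x) => ?; case: (leP 1 _) => ?; lra.
have clamp_lip x y : `|clamp x - clamp y| <= `|x - y|.
  rewrite /clamp !minElt !maxElt; case: (ltP 0 x) => ?; case: (ltP 0 y) => ?;
   do ![case: ifPn; rewrite -?leNgt => ?];
   rewrite ler_norml; apply/andP; split;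
   have := ler_norm (x - y); have := ler_norm (- (x - y)); rewrite normrN; lra.
pose f := g \o clamp.
have cf : continuous f.
  move=> x; apply/cvgrPdist_le => e e0.
  have e1 : 0 < e / (L + 1) by rewrite divr_gt0// ltr_wpDl.
  near=> y; rewrite /f /=.
  rewrite (le_trans (gL _ _ (clamp01 _) (clamp01 _)))//.
  rewrite (le_trans (ler_wpM2l L0 (clamp_lip _ _)))//.
  rewrite (@le_trans _ _ ((L + 1) * `|x - y|))//.
    by rewrite ler_wpM2r// lerDl.
  rewrite -ler_pdivlMl ?ltr_wpDl// mulrC.
  near: y; apply: (@cvgr_dist_le _ _ _ _ _ id x) => //; exact: cvg_id.
have fi : (@lebesgue_measure R).-integrable `[-1, 3] (EFin \o f).
  apply: continuous_compact_integrable; first exact: segment_compact.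
  exact: continuous_subspaceT.
exists (fun x => \int[@lebesgue_measure R]_(t in `[-1, x]) f t)%R => x x01.
have /andP[x0 x1] := x01.
have x3 : x < 3 by lra.
have x_1 : -1 < x by lra.
have [dF F'] := continuous_FTC1_closed x3 fi x_1 (cf x).
split; first exact: dF.
by rewrite -derive1E F' /f /= clampid.
Unshelve. all: by end_near. Qed.

Lemma cvg0_le_near (c e : R) (u : R^nat) : u @ \oo --> (0 : R) -> 0 < e ->
  \forall n \near \oo, c * u n <= e.
Proof.
move=> u0 e0; have : (fun n => c * u n) @ \oo --> (c * 0 : R) by apply: cvgMr.
rewrite mulr0 => /cvgrPdist_le/(_ e e0); apply: filterS => n.
by rewrite sub0r normrN; apply: le_trans; exact: ler_norm.
Qed.

Lemma derive_bound H h r a b : a <= b ->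
  (forall x, a <= x <= b -> is_derive x 1 H (h x)) ->
  (forall x, a <= x <= b -> `|h x| <= r) -> `|H b - H a| <= r * (b - a).
Proof.
move=> ab dF fr.
have [x|x|c] := @MVT_segment R H h a b ab.
- by rewrite in_itv/= => /andP[? ?]; apply: dF; rewrite !ltW.
- move: x; apply: derivable_within_continuous => x; rewrite in_itv/= => xab.
  by have [] := dF x xab.
rewrite in_itv/= => cab ->.
by rewrite normrM (ger0_norm (_ : 0 <= b - a)) ?subr_ge0// ler_wpM2r ?subr_ge0// fr.
Qed.

(* [1 / (1 + x)] is the density of the Gauss measure, up to the factor [1 / ln 2]. *)
Definition gauss_primitive h H := forall x, 0 <= x <= 1 -> is_derive x 1 H (h x / (1 + x)).

Lemma gauss_primitive_exists L h : unit_lip L h -> exists H, gauss_primitive h H.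
Proof.
move=> hL; have hb := unit_lip_bounded hL.
apply: (@unit_lip_primitive (L + (`|h 0| + L))) => x y x01 y01.
have /andP[x0 _] := x01; have /andP[y0 _] := y01.
have hx : 0 < 1 + x by rewrite ltr_wpDr.
have hy : 0 < 1 + y by rewrite ltr_wpDr.
have -> : h x / (1 + x) - h y / (1 + y) =
  ((h x - h y) + h y * (y - x) / (1 + y)) / (1 + x).
  by field; rewrite !gt_eqF.
rewrite normrM normfV [in X in _ / X](ger0_norm (ltW hx)) ler_pdivrMr//.
apply: (@le_trans _ _ ((L + (`|h 0| + L)) * `|x - y|)); last first.
  by rewrite ler_peMr ?lerDl// mulr_ge0// !addr_ge0// (unit_lip_ge0 hL).
rewrite (le_trans (ler_normD _ _))// mulrDl lerD ?hL//.
rewrite !normrM normfV (ger0_norm (ltW hy)) ler_pdivrMr// (distrC y).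
apply: (@le_trans _ _ ((`|h 0| + L) * `|x - y|)); first by rewrite ler_wpM2r// hb.
by rewrite ler_peMr ?lerDl// mulr_ge0// !addr_ge0// (unit_lip_ge0 hL).
Qed.

(** The mean value theorem for [H - c ln (1 + x)], whose derivative [(h x - c) / (1 + x)] is at most
    [r] in absolute value. *)
Lemma gauss_primitive_near h H c r : gauss_primitive h H ->
  (forall x, 0 <= x <= 1 -> `|h x - c| <= r) -> `|H 1 - H 0 - c * ln 2| <= r.
Proof.
move=> hH hr.
have := @derive_bound (H - (fun x => c *: ln (1 + x))) (fun x => (h x - c) / (1 + x)) r 0 1 ler01.
rewrite subr0 mulr1 !fctE addr0 ln1 scaler0 subr0 addrAC; apply.
- move=> x x01; have /andP[x0 _] := x01.
  have hx : 0 < 1 + x by rewrite ltr_wpDr.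
  have dH := hH x x01.
  have dl : is_derive x 1 (@ln R \o (fun x => 1 + x)) ((1 + x)^-1 * (0 + 1)).
    exact: is_derive1_comp (is_derive1_ln hx) (is_deriveD (is_derive_cst _ _ _) (is_derive_id _ _)).
  have := is_deriveB dH (is_deriveZ c dl).
  by move/is_derive_eq; apply; rewrite add0r mulr1 mulrBl.
- move=> x x01; have /andP[x0 _] := x01.
  have hx : 1 <= 1 + x by rewrite lerDl.
  rewrite normrM normfV (ger0_norm (le_trans ler01 hx)) ler_pdivrMr ?(lt_le_trans ltr01)//.
  by rewrite (le_trans (hr x x01))// ler_peMr// (le_trans (normr_ge0 _) (hr x x01)).
Qed.

Lemma expect_tail s B (F : nat -> R) N : 0 <= s <= 1 -> sqrt_growth B F ->
  `|expect s F - series (fun k => weight s k * F k) N| <= 4 * B * (Num.sqrt N.+1%:R)^-1.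
Proof.
move=> s01 FB.
have B0 : 0 <= B by have := le_trans (normr_ge0 _) (FB 0%N); rewrite sqrtr1 mulr1.
pose u k := weight s (N + k) * F (N + k)%N.
have [|k|_] := @telescoping_series_bound R u (fun k => 4 * B * (Num.sqrt (N + k).+1%:R)^-1).
- by move=> k; rewrite /u addnS; exact: expect_telescoping.
- by rewrite mulr_ge0// ?mulr_ge0// invr_ge0 sqrtr_ge0.
rewrite addn0; suff -> : limn (series u) = expect s F -
    series (fun k => weight s k * F k) N by [].
apply/cvg_lim => //.
have -> : series u = (fun n => series (fun k => weight s k * F k) (n + N)%N -
    series (fun k => weight s k * F k) N).
  apply/funext => n; rewrite series_addn [X in _ = X - _]addrC addrK /series /=.
  rewrite -{1}(add0n N) big_addn addnK.
  by apply: eq_bigr => k _; rewrite addnC.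
apply: cvgB; last exact: cvg_cst.
by rewrite (cvg_shiftn N); exact: expect_cvg FB.
Qed.

(* Termwise integration: the tail of the series is uniformly small on [[0, 1]]. *)
Lemma gauss_primitive_series B (F : R -> nat -> R) K (j : nat -> R -> R) :
  gauss_primitive (fun s => expect s (F s)) K ->
  (forall s, 0 <= s <= 1 -> sqrt_growth B (F s)) ->
  (forall k s, 0 <= s <= 1 -> is_derive s 1 (j k) (weight s k * F s k / (1 + s))) ->
  series (fun k => j k 1 - j k 0) @ \oo --> K 1 - K 0.
Proof.
move=> pK FB dj.
have bnd N : `|K 1 - K 0 - series (fun k => j k 1 - j k 0) N| <=
    4 * B * (Num.sqrt N.+1%:R)^-1.
  pose J := fun s => \sum_(k < N) j k s.
  have -> : K 1 - K 0 - series (fun k => j k 1 - j k 0) N = (K - J) 1 - (K - J) 0.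
    rewrite /series /= big_mkord sumrB !fctE /J; ring.
  rewrite -[leRHS]mulr1 -[X in _ <= _ * X](subr0 1).
  apply: (@derive_bound (K - J) (fun s => (expect s (F s) -
     series (fun k => weight s k * F s k) N) / (1 + s)) _ 0 1 ler01) => s s01.
    have dJ : is_derive s 1 J (\sum_(k < N) (weight s k * F s k / (1 + s))).
      have -> : J = \sum_(k < N) j k by apply/funext => x; rewrite fct_sumE.
      by apply: is_derive_sum => k; exact: dj.
    have := is_deriveB (pK s s01) dJ; move/is_derive_eq; apply.
    by rewrite mulrBl /series /= big_mkord mulr_suml.
  have /andP[s0 _] := s01.
  have hs : 1 <= 1 + s by rewrite lerDl.
  rewrite normrM normfV (ger0_norm (le_trans ler01 hs)) ler_pdivrMr ?(lt_le_trans ltr01)//.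
  have T := expect_tail N s01 (FB s s01).
  by rewrite (le_trans T)// ler_peMr// (le_trans (normr_ge0 _) T).
apply/cvgrPdist_le => e e0.
have := cvg0_le_near (4 * B) (@cvg_inv_sqrt R) e0.
by apply: filterS => N; apply: le_trans; exact: bnd.
Qed.

Lemma is_derive_natS_add k s : is_derive s 1 (fun x => k.+1%:R + x) 1.
Proof.
have := is_deriveD (is_derive_cst (k.+1%:R : R) s (1 : R)) (is_derive_id s (1 : R)).
by move/is_derive_eq; apply; rewrite add0r.
Qed.

(** The substitution [x = 1 / (k + 1 + s)] turns the [k]-th term of the integral of [transfer h]
    into the integral of [h x / (1 + x)] over [[1 / (k + 2), 1 / (k + 1)]]. These intervals fill
    [(0, 1]], so [c1] and [c2] evaluate the same series. *)
Lemma transfer_invariant L h H K : unit_lip L h ->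
  gauss_primitive h H -> gauss_primitive (transfer h) K -> K 1 - K 0 = H 1 - H 0.
Proof.
move=> hL pH pK; have hb := unit_lip_bounded hL.
set B := `|h 0| + L in hb.
pose F s k := h ((k.+1%:R + s)^-1).
pose j k s := - H ((k.+1%:R + s)^-1).
have c1 : series (fun k => j k 1 - j k 0) @ \oo --> K 1 - K 0.
  apply: (@gauss_primitive_series B F K j pK).
    by move=> s /andP[s0 _]; exact: transfer_growth.
  move=> k s s01; have /andP[s0 _] := s01; have hk := natS_gt0 k s0.
  have dH := pH _ (inv_natS_itv k s0).
  have dV := is_deriveV (f := fun x => k.+1%:R + x) (lt0r_neq0 hk) (is_derive_natS_add k s).
  have := is_deriveN (@is_derive1_comp R H (fun x => (k.+1%:R + x)^-1) s _ _ dH dV).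
  move/is_derive_eq; apply.
  rewrite /weight /F [_ *: 1]mulr1 -[k.+2%:R]natr1.
  have hk1 : 0 < k.+1%:R + 1 + s by rewrite addrAC ltr_wpDr.
  have s1 : 0 < 1 + s by rewrite ltr_wpDr.
  move: k.+1%:R hk hk1 {dH dV} => a hk hk1.
  (* Hence the density [1 / (1 + x)] at [x = 1 / (a + s)], times the Jacobian [1 / (a + s)^2], is
     [weight s k / (1 + s)]. *)
  have h3 : 1 + (a + s)^-1 = (a + 1 + s) / (a + s) by field; rewrite gt_eqF.
  by rewrite h3; field; rewrite !gt_eqF.
have c2 : series (fun k => j k 1 - j k 0) @ \oo --> H 1 - H 0.
  have jE k : j k 1 - j k 0 = H (k.+1%:R^-1) - H (k.+2%:R^-1).
    by rewrite /j addr0 natr1; ring.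
  have bnd N : `|H 1 - H 0 - series (fun k => j k 1 - j k 0) N| <= B * N.+1%:R^-1.
    have -> : series (fun k => j k 1 - j k 0) N = H 1 - H (N.+1%:R^-1).
      elim: N => [|N IH]; first by rewrite /series /= big_geq// invr1 subrr.
      by rewrite seriesSr IH jE; ring.
    have -> : H 1 - H 0 - (H 1 - H (N.+1%:R^-1)) = H (N.+1%:R^-1) - H 0 by ring.
    rewrite -[X in _ <= _ * X]subr0.
    have /andP[n0 n1] := inv_natS_itv N (lexx (0 : R)); rewrite addr0 in n0 n1.
    have n01 x : 0 <= x <= N.+1%:R^-1 -> 0 <= x <= 1.
      by case/andP=> -> /le_trans; apply.
    apply: (@derive_bound H (fun x => h x / (1 + x)) _ _ _ n0) => x /n01 x01; first exact: pH.
    have /andP[x0 _] := x01.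
    have hs : 1 <= 1 + x by rewrite lerDl.
    rewrite normrM normfV (ger0_norm (le_trans ler01 hs)) ler_pdivrMr ?(lt_le_trans ltr01)//.
    by rewrite (le_trans (hb x x01))// ler_peMr// (le_trans (normr_ge0 _) (hb x x01)).
  apply/cvgrPdist_le => e e0.
  have := cvg0_le_near B (@cvg_harmonic R) e0.
  by apply: filterS => N; apply: le_trans; exact: bnd.
exact: (cvg_unique _ c1 c2).
Qed.

(** Termwise, [weight s k / (1 + s)] has the primitive [ln ((k + 1 + s) / (k + 2 + s))]. With
    [r = k + 1], its increment over [[0, 1]] is the logarithm of [(r + 1)^2 / (r (r + 2)) = 1 + 1 /
    (r (r + 2))]. *)
Lemma mean_log_integral K : gauss_primitive (@mean_log R) K ->
  series (fun k => ln k.+1%:R * ln (1 + (k.+1%:R * (k.+1%:R + 2))^-1)) @ \oo --> K 1 - K 0.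
Proof.
move=> pK.
pose j k s : R := ln k.+1%:R * (ln (k.+1%:R + s) - ln (k.+2%:R + s)).
have -> : (fun k => ln k.+1%:R * ln (1 + (k.+1%:R * (k.+1%:R + 2))^-1)) =
    (fun k => j k 1 - j k 0).
  apply/funext => k; rewrite /j -mulrBr; congr (_ * _).
  rewrite !addr0 !natr1 opprB addrACA -[in RHS]addrA.
  have -> : 1 + (k.+1%:R * (k.+1%:R + 2))^-1 = (k.+2%:R / k.+3%:R) * (k.+2%:R / k.+1%:R) :> R.
    rewrite -[k.+3%:R]natr1 -[k.+2%:R]natr1.
    have : 0 < k.+1%:R :> R by [].
    move: k.+1%:R => a a0; field; rewrite !gt_eqF//; lra.
  rewrite lnM ?posrE ?divr_gt0// !ln_div ?posrE//; ring.
apply: (@gauss_primitive_series 4 (fun=> @log_digit R) K j pK).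
  by move=> s _; exact: log_digit_growth.
move=> k s /andP[s0 _]; have hk := natS_gt0 k s0; have hk1 := natS_gt0 k.+1 s0.
have dl i : 0 < i.+1%:R + s ->
    is_derive s 1 (@ln R \o (fun x => i.+1%:R + x)) ((i.+1%:R + s)^-1 * 1).
  by move=> hi; exact: (@is_derive1_comp R (@ln R) (fun x => i.+1%:R + x) s _ _
    (is_derive1_ln hi) (is_derive_natS_add i s)).
have := is_deriveZ (ln k.+1%:R) (is_deriveB (dl k hk) (dl k.+1 hk1)).
move/is_derive_eq; apply.
rewrite /weight /log_digit !mulr1 /GRing.scale/=.
have s1 : 0 < 1 + s by rewrite ltr_wpDr.
move: hk hk1; rewrite -[k.+2%:R]natr1.
move: (ln _) => l; move: k.+1%:R => a hk hk1.
by field; rewrite !gt_eqF.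
Qed.

(** This is [ln 2] times the logarithm of Khinchin's constant; see [khinchin_K0E]. *)
Definition log_K0_sum : R :=
  limn (series (fun k => ln k.+1%:R * ln (1 + (k.+1%:R * (k.+1%:R + 2))^-1))).

(** Convergence is read off from the integral of [mean_log], without estimating the terms. *)
Lemma log_K0_sum_cvg :
  series (fun k => ln k.+1%:R * ln (1 + (k.+1%:R * (k.+1%:R + 2))^-1)) @ \oo --> log_K0_sum.
Proof.
have [|K pK] := @gauss_primitive_exists 1 (@mean_log R).
  by move=> x y x01 y01; rewrite mul1r mean_log_lip.
by apply/cvg_ex; exists (K 1 - K 0); exact: mean_log_integral.
Qed.

(** By invariance all iterates have the integral [log_K0_sum]. By contraction the [M]-th one is
    within [(17 / 20) ^+ M] of its value at [s], so that value times [ln 2] is close to the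
    integral. *)
Lemma iter_transfer_near M s : 0 <= s <= 1 ->
  `|iter M (@transfer R) (@mean_log R) s - log_K0_sum / ln 2| <= (17 / 20) ^+ M / ln 2.
Proof.
move=> s01.
have inv K : gauss_primitive (iter M (@transfer R) (@mean_log R)) K -> K 1 - K 0 = log_K0_sum.
  elim: M K => [|M IH] K pK.
    by apply: (cvg_unique _ (mean_log_integral pK) log_K0_sum_cvg).
  have lM := @iter_transfer_lip R M.
  have [H pH] := gauss_primitive_exists lM.
  by rewrite (transfer_invariant lM pH pK) IH.
have lM := @iter_transfer_lip R M.
have [H pH] := gauss_primitive_exists lM.
have l2 : 0 < ln 2 :> R by rewrite ln_gt0 ?ltr1n.
have := @gauss_primitive_near _ H (iter M (@transfer R) (@mean_log R) s) ((17 / 20) ^+ M) pH.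
rewrite inv// => h.
rewrite ler_pdivlMr// -[X in _ * X](ger0_norm (ltW l2)) -normrM mulrBl divfK ?gt_eqF//.
rewrite distrC; apply: h => x x01.
rewrite (le_trans (lM _ _ x01 s01))// ler_piMr ?exprn_ge0//.
case/andP: x01 s01 => ? ? /andP[? ?]; rewrite ler_norml; apply/andP; split; lra.
Qed.

Lemma approx_poisson (e : R) : 0 < e -> exists L u, unit_lip L u /\
  forall s, 0 <= s <= 1 -> `|mean_log s + transfer u s - u s - log_K0_sum / ln 2| <= e.
Proof.
move=> e0; have l2 : 0 < ln 2 :> R by rewrite ln_gt0 ?ltr1n.
have : (fun M => (17 / 20 : R) ^+ M) @ \oo --> (0 : R) by apply: cvg_expr; rewrite ger0_norm; lra.
move=> /cvgrPdist_le/(_ (e * ln 2) (mulr_gt0 e0 l2))[M _ hM].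
have [L [u [uL uE]]] := @poisson_equation R M.
exists L, u; split=> // s s01; rewrite uE//.
rewrite (le_trans (iter_transfer_near M s01))// ler_pdivrMr//.
by have := hM M (leqnn M); rewrite sub0r normrN ger0_norm// exprn_ge0.
Qed.

End invariant_functional.

(** * Variance bound for the digit martingale *)

Section coverable.
Variable R : realType.
Implicit Types (A : set R) (e : R).

(* Bounding the measure of a measurable superset spares every measurability
   argument about the digits. *)
Definition coverable A e := exists B : set R,
  [/\ measurable B, A `<=` B & (lebesgue_measure B <= e%:E)%E].

Lemma coverableS A A' e e' : A `<=` A' -> e' <= e -> coverable A' e' -> coverable A e.
Proof.
move=> AA ee [B [mB AB Be]]; exists B; split => //; first exact: subset_trans AB.
by rewrite (le_trans Be)// lee_fin.
Qed.

Lemma coverable0 e : 0 <= e -> coverable set0 e.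
Proof. by move=> e0; exists set0; split=> //; rewrite measure0 lee_fin. Qed.

(** The endpoints come in either order, since the orientation of a cylinder alternates with the
    number of digits. *)
Lemma coverable_segment (a b : R) :
  coverable [set x | exists2 t, 0 <= t <= 1 & x = a + t * (b - a)] `|b - a|.
Proof.
wlog ab : a b / a <= b.
  move=> W; case: (leP a b) => [/W//|/ltW/W]; rewrite distrC.
  apply: coverableS => // x /= [t /andP[t0 t1] ->]; exists (1 - t); last ring.
  by apply/andP; split; lra.
exists `[a, b]%classic; split.
- exact: measurable_itv.
- move=> _ [t /andP[t0 t1] ->] /=; rewrite in_itv/=.
  have := mulr_ge0 t0 (_ : 0 <= b - a); rewrite subr_ge0 => /(_ ab) h.
  have := mulr_ge0 (_ : 0 <= 1 - t) (_ : 0 <= b - a); rewrite !subr_ge0 => /(_ t1 ab) h'.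
  apply/andP; split; lra.
- rewrite lebesgue_measure_itv/= lte_fin ger0_norm ?subr_ge0//.
  by case: ifPn => _; rewrite ?lee_fin ?subr_ge0.
Qed.

Lemma nneseries_EFin (v : R^nat) l : (forall k, 0 <= v k) -> series v @ \oo --> l ->
  (\sum_(k <oo) (v k)%:E = l%:E)%E.
Proof.
move=> v0 vl; apply/cvg_lim => //.
have -> : (fun n => \sum_(0 <= k < n) (v k)%:E)%E = EFin \o series v.
  by apply/funext => n /=; rewrite sumEFin.
by apply: cvg_EFin; [exact: nearW|exact: vl].
Qed.

Lemma coverable_bigcup (A : (set R)^nat) (e : R^nat) l : (forall k, coverable (A k) (e k)) ->
  (forall k, 0 <= e k) -> series e @ \oo --> l -> coverable (\bigcup_k A k) l.
Proof.
move=> /choice[B HB] e0 el; exists (\bigcup_k B k); split.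
- by apply: bigcup_measurable => k _; have [] := HB k.
- by apply: subset_bigcup => k _; have [] := HB k.
- rewrite -(nneseries_EFin e0 el).
  apply: (@le_trans _ _ (\sum_(k <oo) lebesgue_measure (B k))%E).
    apply: measure_sigma_subadditive => //; first by move=> k; have [] := HB k.
    by apply: bigcup_measurable => k _; have [] := HB k.
  by apply: lee_nneseries => k _ //; have [] := HB k.
Qed.

(** The Borel-Cantelli lemma, applied to the measurable covers. *)
Lemma coverable_lim_sup_negligible (A : (set R)^nat) (e : R^nat) :
  (forall k, coverable (A k) (e k)) -> (forall k, 0 <= e k) -> cvgn (series e) ->
  (@lebesgue_measure R).-negligible (lim_sup_set A).
Proof.
move=> /choice[B HB] e0 el.
have mB k : measurable (B k) by have [] := HB k.
suff N : (@lebesgue_measure R).-negligible (lim_sup_set B).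
  apply: negligibleS N.
  move=> x Ax n _; have [j nj Aj] := Ax n I; exists j => //.
  by have [_ + _] := HB j; apply.
apply/negligibleP.
  apply: bigcap_measurable => // k _.
  by apply: bigcup_measurable => j _; exact: mB.
apply: lim_sup_set_cvg0 => //.
apply: (@le_lt_trans _ _ (\sum_(k <oo) (e k)%:E)%E).
  by apply: lee_nneseries => k _ //; have [] := HB k.
by rewrite (nneseries_EFin e0 el) ltry.
Qed.

End coverable.

(** * Continued fraction digits and the Gauss map *)

Section digits.
Variable R : realType.
Implicit Types x y : R.

Lemma cf_digitS i y : cf_digit i.+2 y = cf_digit i.+1 (gauss y).
Proof. by rewrite /cf_digit /= -iterSr. Qed.

Lemma irrational_gauss y : irrational y -> irrational (gauss y).
Proof.
move=> iy [q _ qE]; apply: iy; exists (q + (Num.floor y^-1)%:~R)^-1 => //.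
by rewrite fmorphV rmorphD/= qE ratr_int /gauss subrK invrK.
Qed.

(** The value [0] is excluded because [gauss] preserves irrationality. *)
Lemma gauss_itv y : 0 < y < 1 -> irrational y -> 0 < gauss y < 1.
Proof.
move=> /andP[y0 y1] iy; have := irrational_gauss iy.
have /andP[f1 f2] := real_floor_itv (num_real y^-1).
rewrite /gauss subr_gt0 ltrBlDl -intrD1 f2 andbT => ig.
rewrite lt_neqAle f1 andbT; apply/eqP => E; apply: ig.
by rewrite /gauss E subrr; exists 0 => //; rewrite rmorph0.
Qed.

Lemma cf_digit1E y : 0 < y < 1 -> (0 < cf_digit 1 y)%N /\ y = ((cf_digit 1 y)%:R + gauss y)^-1.
Proof.
move=> /andP[y0 y1]; rewrite /cf_digit/= /gauss.
have y'1 : 1 <= y^-1 by rewrite invf_ge1// ltW.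
have y'0 : 0 <= y^-1 by rewrite (le_trans ler01).
split; first by rewrite truncn_gt0.
have -> : (Num.truncn y^-1)%:R = (Num.floor y^-1)%:~R :> R.
  by rewrite truncn_floor y'0 natr_absz ger0_norm// floor_ge0.
by rewrite addrC subrK invrK.
Qed.

Lemma cf_digit_gt0 i y : 0 < y < 1 -> irrational y -> (0 < cf_digit i.+1 y)%N.
Proof.
elim: i y => [|i IH] y y01 iy; first by have [] := cf_digit1E y01.
by rewrite cf_digitS IH//; [exact: gauss_itv|exact: irrational_gauss].
Qed.

End digits.

(** * Chebyshev's inequality for the digit martingale *)

Section martingale.
Variable R : realType.
Implicit Types (s x y m : R).
Variables (u : R -> R) (L : R).
Hypothesis uL : unit_lip L u.

Definition increment s (k : nat) : R :=
  log_digit R k + (u ((k.+1%:R + s)^-1) - (mean_log s + transfer u s)).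

(** The recursion reads the first digit of [y] and carries the state [s] forward; [s] stands for
    [q_(n-1) / q_n] of the digits already read. *)
Fixpoint martingale n s y : R :=
  if n is n'.+1 then increment s (cf_digit 1 y).-1 +
    martingale n' (((cf_digit 1 y)%:R + s)^-1) (gauss y) else 0.

Lemma increment_bound : exists b, forall s, 0 <= s <= 1 -> forall k,
  `|increment s k| <= log_digit R k + b.
Proof.
have ub := unit_lip_bounded uL; set B := `|u 0| + L in ub.
exists (B + (4 * 4 + 4 * B)) => s s01 k; have /andP[s0 _] := s01.
have /andP[l0 _] := log_digit_le R k.
rewrite (le_trans (ler_normD _ _))// (ger0_norm l0) lerD2l.
rewrite (le_trans (ler_normB _ _))// lerD//; first exact/ub/inv_natS_itv.
rewrite (le_trans (ler_normD _ _))// lerD//; first exact: expect_le (@log_digit_growth R).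
exact: expect_le (transfer_growth s0 ub).
Qed.

(* The last term of [increment] centres it, so the cross term [2 m * increment]
   contributes nothing. *)
Lemma increment_moment : exists2 C, 0 <= C & forall s m, 0 <= s <= 1 -> exists2 v, v <= m ^+ 2 + C &
  series (fun k => weight s k * (m + increment s k) ^+ 2) @ \oo --> v.
Proof.
have [b ib] := increment_bound; have [B2 gB] := sqr_log_digit_growth b.
have B20 : 0 <= B2.
  have := gB _ (ib 0 _); rewrite !lexx ler01 => /(_ isT) h.
  by have := le_trans (normr_ge0 _) (h 0%N); rewrite sqrtr1 mulr1.
exists (4 * B2); first by rewrite mulr_ge0.
move=> s m s01; have /andP[s0 _] := s01.
have ub := unit_lip_bounded uL; set B := `|u 0| + L in ub.
have g1 := @log_digit_growth R; have g2 := transfer_growth s0 ub.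
pose d := mean_log s + transfer u s.
have g3 : sqrt_growth `|- d| (fun=> - d) by apply: sqrt_growth_bounded.
have g23 := sqrt_growthD g2 g3; have gI := sqrt_growthD g1 g23.
have E0 : expect s (increment s) = 0.
  rewrite (expectD s01 g1 g23) (expectD s01 g2 g3) expect_cst//.
  rewrite -/(mean_log s) -/(transfer u s) /d; ring.
have gI2 := gB _ (ib s s01).
have g4 := sqrt_growthZ (2 * m) gI; have g5 := sqrt_growthD g4 gI2.
have g6 : sqrt_growth `|m ^+ 2| (fun=> m ^+ 2) by apply: sqrt_growth_bounded.
have g7 := sqrt_growthD g6 g5.
exists (m ^+ 2 + expect s (fun k => increment s k ^+ 2)).
  by rewrite lerD2l (le_trans (ler_norm _))// (expect_le s01 gI2).
have := expect_cvg s01 g7.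
rewrite (expectD s01 g6 g5) (expectD s01 g4 gI2) (expectZ _ s01 gI).
rewrite E0 mulr0 add0r expect_cst//.
suff -> : (fun k => weight s k * (m ^+ 2 + (2 * m * (log_digit R k +
    (u ((k.+1%:R + s)^-1) + - d)) + increment s k ^+ 2))) =
  (fun k => weight s k * (m + increment s k) ^+ 2) by [].
by apply/funext => k; rewrite /increment -/d; ring.
Qed.

(* Chebyshev's inequality on the cylinder [{(p + p' y) / (q + q' y)}], whose
   length is the factor in front.  Splitting by the first digit of [y] gives
   subcylinders of the same shape, with [weight (q' / q)] as relative lengths. *)
Lemma martingale_coverable : exists2 C, 0 <= C & forall t n (p p' q q' m : R), 0 < t ->
  0 < q -> 0 <= q' <= q ->
  coverable [set x | exists y, [/\ 0 < y < 1, irrational y,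
     x = (p + p' * y) / (q + q' * y) & t <= (m + martingale n (q' / q) y) ^+ 2]]
    (`|p * q' - p' * q| / (q * (q + q')) * ((m ^+ 2 + C * n%:R) / t)).
Proof.
have [C C0 HC] := increment_moment; exists C => // t n p p' q q' m t0.
have det0 (a b c : R) : 0 < b -> 0 <= c -> 0 <= `|a| / (b * (b + c)) :> R.
  by move=> b0 c0; rewrite divr_ge0// mulr_ge0 ?addr_ge0 ?(ltW b0).
elim: n p p' q q' m => [|n IH] p p' q q' m q0 /andP[q'0 q'q].
  (* With no digit left, the set is empty if [m ^+ 2 < t]; otherwise it lies in the whole cylinder,
     and the factor [m ^+ 2 / t] is at least [1]. *)
  rewrite (mulr0 C) (addr0 (m ^+ 2)); case: (leP t (m ^+ 2)) => tm; last first.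
    apply: (coverableS _ (lexx _) (@coverable0 R _ _)); last first.
      by rewrite mulr_ge0 ?det0// divr_ge0 ?sqr_ge0// ltW.
    by move=> x [y [_ _ _]] /=; rewrite (addr0 m) leNgt tm.
  have qq : 0 < q + q' by rewrite ltr_wpDr.
  apply: (coverableS _ _ (@coverable_segment R (p / q) ((p + p') / (q + q')))).
    move=> x [y [/andP[y0 y1] _ -> _]] /=.
    have qy : 0 < q + q' * y by rewrite ltr_wpDr// mulr_ge0// ltW.
    exists (y * (q + q') / (q + q' * y)).
      apply/andP; split; first by rewrite divr_ge0 ?mulr_ge0// ltW.
      rewrite ler_pdivrMr// mul1r.
      have : 0 <= q * (1 - y) by rewrite mulr_ge0// ?subr_ge0 ltW.
      lra.
    by field; rewrite !gt_eqF.
  have -> : (p + p') / (q + q') - p / q = - (p * q' - p' * q) / (q * (q + q')).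
    by field; rewrite !gt_eqF.
  rewrite normrM normrN normfV (ger0_norm (_ : 0 <= q * (q + q'))); last first.
    by rewrite mulr_ge0// ltW.
  by rewrite ler_peMr ?det0// ler_pdivlMr// mul1r.
have s01 : 0 <= q' / q <= 1 by rewrite divr_ge0 ?(ltW q0)//= ler_pdivrMr// mul1r.
set s := q' / q in s01 *; have /andP[s0 s1] := s01.
have [v vC vl] := HC s m s01.
have Q0 k : 0 < q * k.+1%:R + q' by rewrite ltr_wpDr// mulr_gt0.
have Qq k : 0 <= q <= q * k.+1%:R + q'.
  by rewrite (ltW q0)/= -[leLHS]addr0 lerD// ler_peMr ?(ltW q0)// ler1n.
(* The new coefficients come from substituting [y = 1 / (k.+1 + z)] into
   [(p + p' y) / (q + q' y)]. *)
have cov k := IH (p * k.+1%:R + p') p (q * k.+1%:R + q') q (m + increment s k) (Q0 k) (Qq k).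
set D := `|p * q' - p' * q| / (q * (q + q')).
have D0 : 0 <= D by exact: det0.
(* The determinant only changes sign, so the ratio of the two lengths is [weight s k]. *)
have eE k : `|(p * k.+1%:R + p') * q - p * (q * k.+1%:R + q')| /
     ((q * k.+1%:R + q') * (q * k.+1%:R + q' + q)) *
     (((m + increment s k) ^+ 2 + C * n%:R) / t) =
   D / t * (weight s k * (m + increment s k) ^+ 2) + D / t * (C * n%:R) * weight s k.
  have -> : (p * k.+1%:R + p') * q - p * (q * k.+1%:R + q') = - (p * q' - p' * q) by ring.
  rewrite normrN /D /weight /s -[k.+2%:R]natr1.
  have k0 : 0 < k.+1%:R :> R by [].
  have := Q0 k; move: (increment _ _) `|_| k.+1%:R k0 => I d a a0 Qa.
  field; rewrite !gt_eqF//; nra.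
have e0 k : 0 <= `|(p * k.+1%:R + p') * q - p * (q * k.+1%:R + q')| /
     ((q * k.+1%:R + q') * (q * k.+1%:R + q' + q)) *
     (((m + increment s k) ^+ 2 + C * n%:R) / t).
  by rewrite mulr_ge0 ?det0// ?(ltW q0)// divr_ge0 ?(ltW t0)// addr_ge0 ?sqr_ge0// mulr_ge0.
have el : series (fun k => `|(p * k.+1%:R + p') * q - p * (q * k.+1%:R + q')| /
     ((q * k.+1%:R + q') * (q * k.+1%:R + q' + q)) *
     (((m + increment s k) ^+ 2 + C * n%:R) / t)) @ \oo --> D / t * v + D / t * (C * n%:R).
  rewrite (funext eE).
  have -> : series (fun k => D / t * (weight s k * (m + increment s k) ^+ 2) +
     D / t * (C * n%:R) * weight s k) =
    (fun N => D / t * series (fun k => weight s k * (m + increment s k) ^+ 2) N +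
      D / t * (C * n%:R) * series (weight s) N).
    by apply/funext => N; rewrite /series/= big_split/= !mulr_sumr.
  apply: cvgD; first exact: cvgMr.
  by rewrite -[X in _ --> X]mulr1; apply: cvgMr; exact: weight_cvg.
have cU := coverable_bigcup cov e0 el.
apply: coverableS cU.
- move=> x [y [y01 iy xE ty]].
  have [d0 yE] := cf_digit1E y01.
  exists (cf_digit 1 y).-1 => //; exists (gauss y).
  have dE : (cf_digit 1 y).-1.+1 = cf_digit 1 y by rewrite prednK.
  have gy := gauss_itv y01 iy; have /andP[g0 g1] := gy.
  rewrite dE; split=> //; first exact: irrational_gauss.
    have a0 : 0 < (cf_digit 1 y)%:R :> R by rewrite ltr0n.
    rewrite xE {1 2}yE; move: (gauss y) g0 {g1 gy} => z z0.
    move: (cf_digit 1 y)%:R a0 => a a0.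
    have az : 0 < a + z by rewrite addr_gt0.
    have -> : p + p' / (a + z) = (p * a + p' + p * z) / (a + z) by field; rewrite gt_eqF.
    have -> : q + q' / (a + z) = (q * a + q' + q * z) / (a + z) by field; rewrite gt_eqF.
    have : 0 < q * a + q' + q * z.
      by rewrite ltr_wpDr ?mulr_ge0 ?(ltW q0) ?(ltW z0)// ltr_wpDr// mulr_gt0.
    by move=> h; field; rewrite !gt_eqF.
  move: ty => /=; rewrite addrA.
  suff -> : q / (q * (cf_digit 1 y)%:R + q') = ((cf_digit 1 y)%:R + s)^-1 by [].
  have := Q0 (cf_digit 1 y).-1; rewrite dE /s; move: (cf_digit 1 y)%:R => a Qa.
  have -> : a + q' / q = (q * a + q') / q by field; rewrite gt_eqF.
  by rewrite invf_div.
(* The current digit adds at most [C] to [m ^+ 2], the remaining ones [C * n]. *)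
- rewrite -/D [leRHS]mulrA [leRHS]mulrAC -mulrDr ler_wpM2l//.
    by rewrite divr_ge0// ltW.
  by rewrite -natr1 mulrDr mulr1 addrA addrAC lerD2r.
Qed.

(** The values of [u] telescope along the states, leaving only the last one, bounded by [B]; each
    digit adds a drift of at most [e]. *)
Lemma martingale_near c (e B : R) : (forall x, 0 <= x <= 1 -> `|u x| <= B) ->
  (forall s, 0 <= s <= 1 -> `|mean_log s + transfer u s - u s - c| <= e) ->
  forall n s y, 0 <= s <= 1 -> 0 < y < 1 -> irrational y ->
  `|martingale n s y + u s - (\sum_(i < n) ln (cf_digit i.+1 y)%:R - c * n%:R)| <= e * n%:R + B.
Proof.
move=> uB ue; elim=> [|n IH] s y s01 y01 iy.
  by rewrite big_ord0 !mulr0 subrr subr0 !add0r uB.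
have [d0 _] := cf_digit1E y01; have /andP[s0 _] := s01.
have dE : (cf_digit 1 y).-1.+1 = cf_digit 1 y by rewrite prednK.
have s'01 := inv_natS_itv (cf_digit 1 y).-1 s0; rewrite dE in s'01.
have := IH _ _ s'01 (gauss_itv y01 iy) (irrational_gauss iy).
rewrite big_ord_recl /= /increment /log_digit dE.
under [in X in _ -> X]eq_bigr do rewrite /bump /= add1n cf_digitS.
set s' := _^-1; set M := martingale _ _ _; set S := \sum_(i < n) _ => h.
have -> : ln (cf_digit 1 y)%:R + (u s' - (mean_log s + transfer u s)) + M + u s -
    (ln (cf_digit 1 y)%:R + S - c * n.+1%:R) =
  (M + u s' - (S - c * n%:R)) - (mean_log s + transfer u s - u s - c).
  by rewrite -natr1; ring.
have -> : e * n.+1%:R + B = (e * n%:R + B) + e by rewrite -natr1; ring.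
by rewrite (le_trans (ler_normB _ _))// lerD// ue.
Qed.

End martingale.

(** * Geometric mean of the digits *)

Section khinchin.
Variable R : realType.
Implicit Types (y e c : R).

Definition log_digit_sum y n : R := \sum_(i < n) ln (cf_digit i.+1 y)%:R.

Definition square (j : nat) : nat := (j.+1 ^ 2)%N.

(** Chebyshev at threshold [e * N], with [N = square j], gives the exceptional measure
    [C / (e^2 N)], which is summable along squares. The factor [3] counts the martingale, the drift
    and the bounded terms, each at most [e * N] eventually. *)
Lemma square_deviation (c e : R) : 0 < e ->
  (exists L u, unit_lip L u /\
    forall s, 0 <= s <= 1 -> `|mean_log s + transfer u s - u s - c| <= e) ->
  {ae @lebesgue_measure R, forall y, 0 < y < 1 -> irrational y ->
    \forall j \near \oo,
      `|log_digit_sum y (square j) - c * (square j)%:R| <= 3 * e * (square j)%:R}.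
Proof.
move=> e0 [L [u [uL ue]]].
have [C C0 HC] := martingale_coverable uL.
have ub := unit_lip_bounded uL; set B := `|u 0| + L in ub.
pose N j : R := (square j)%:R.
have NE j : N j = j.+1%:R ^+ 2 by rewrite /N /square natrX.
have N0 j : 0 < N j by rewrite NE exprn_gt0.
pose A j := [set y | [/\ 0 < y < 1, irrational y &
  (e * N j) ^+ 2 <= martingale u (square j) 0 y ^+ 2]].
have covA j : coverable (A j) (C / e ^+ 2 * (N j)^-1).
  (* These coefficients give the identity map: the cylinder of no digits, with state [0]. *)
  have := HC ((e * N j) ^+ 2) (square j) 0 1 1 0 0.
  rewrite !lexx ler01 ltr01 exprn_gt0 ?mulr_gt0// => /(_ isT isT isT).
  apply: coverableS.
    move=> y [y01 iy hy] /=; exists y; split=> //.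
      by rewrite mul1r mul0r addr0 divr1 add0r.
    by rewrite mul0r add0r.
  rewrite mul0r sub0r mulr1 normrN1 addr0 mulr1 divr1 mul1r expr0n/= add0r.
  rewrite le_eqVlt; apply/orP; left; apply/eqP.
  by rewrite -/(N j); field; rewrite !gt_eqF.
have D0 : 0 <= C / e ^+ 2 by rewrite divr_ge0 ?sqr_ge0.
have eA0 j : 0 <= C / e ^+ 2 * (N j)^-1 by rewrite mulr_ge0// invr_ge0 ltW.
have [|j|cA _] := @telescoping_series_bound R (fun j => C / e ^+ 2 * (N j)^-1)
  (fun j => 2 * (C / e ^+ 2) * j.+1%:R^-1).
- move=> j; rewrite ger0_norm// NE -[j.+2%:R]natr1.
  move: (C / _) D0 {eA0 covA} => D D0.
  have : 1 <= j.+1%:R :> R by rewrite ler1n.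
  move: j.+1%:R => a a1; rewrite -subr_ge0.
  have -> : 2 * D / a - 2 * D / (a + 1) - D / a ^+ 2 = D * (a - 1) / (a ^+ 2 * (a + 1)).
    by field; rewrite !gt_eqF//; lra.
  by rewrite divr_ge0 ?mulr_ge0 ?exprn_ge0//; lra.
- by rewrite mulr_ge0 ?invr_ge0// mulr_ge0.
have := coverable_lim_sup_negligible covA eA0 cA; apply: negligibleS => y /= nP n _.
apply: contrapT => nA; apply: nP => y01 iy.
near=> j.
have nj : (n <= j)%N by near: j; exact: nbhs_infty_ge.
have Mj : `|martingale u (square j) 0 y| <= e * N j.
  rewrite leNgt; apply/negP => lt; apply: nA; exists j => //; split=> //.
  have eN : 0 <= e * N j by rewrite mulr_ge0// ltW.
  by rewrite -[leRHS]real_normK ?num_real// ler_sqr ?nnegrE// ltW.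
have := martingale_near ub ue (square j) (s := 0) _ y01 iy; rewrite lexx ler01 => /(_ isT).
rewrite -/(log_digit_sum y (square j)) -/(N j).
have u0 : `|u 0| <= B by apply: ub; rewrite lexx ler01.
set S := log_digit_sum _ _ - _; set M := martingale _ _ _ _ in Mj * => h.
have -> : S = (M + u 0) - (M + u 0 - S) by ring.
rewrite (le_trans (ler_normB _ _))//.
have Bj : B + B <= e * N j.
  have : (B + B) / e <= j%:R by near: j; exact: nbhs_infty_ger.
  rewrite ler_pdivrMr// mulrC => /le_trans; apply.
  rewrite ler_wpM2l ?(ltW e0)// NE -natr1.
  have : 0 <= j%:R :> R by [].
  nra.
have := ler_normD M (u 0); lra.
Unshelve. all: by end_near. Qed.

(** Monotonicity traps [S n] between its values at the squares enclosing [n], whose distance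
    [2 r + 1] is negligible against [n]. *)
Lemma cvg_mean_of_squares (S : R^nat) c : {homo S : m n / (m <= n)%N >-> m <= n} ->
  (forall e, 0 < e -> \forall j \near \oo,
     `|S (square j) - c * (square j)%:R| <= e * (square j)%:R) ->
  (fun n => n%:R^-1 * S n) @ \oo --> c.
Proof.
move=> mS H; apply/cvgrPdist_le => e e0.
(* One fifth pays for the gap between [n] and the enclosing squares, four fifths for the deviation
   at [(r + 1)^2 <= 4 r^2]. *)
have e4 : 0 < e / 5 by rewrite divr_gt0.
have [J _ HJ] := H _ e4.
near=> n.
have n0 : (0 < n)%N by near: n; exact: nbhs_infty_gt.
pose r := Num.truncn (Num.sqrt n%:R : R).
have s0 : 0 <= Num.sqrt n%:R :> R by exact: sqrtr_ge0.
have sE : Num.sqrt n%:R ^+ 2 = n%:R :> R by rewrite sqr_sqrtr.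
have rs : r%:R <= Num.sqrt n%:R :> R by rewrite truncn_le.
have sr : Num.sqrt n%:R < r.+1%:R :> R by rewrite -truncn_le_nat.
have rge m : (m ^ 2 <= n)%N -> (m <= r)%N.
  move=> mn; rewrite -ltnS -(ltr_nat R) (le_lt_trans _ sr)//.
  by rewrite -(@ler_sqr R) ?nnegrE// sE -natrX ler_nat.
have rJ : (J.+1 <= r)%N by apply: rge; near: n; exact: nbhs_infty_ge.
have r0 : (0 < r)%N by exact: leq_trans rJ.
(* Because of the shift in [square], the enclosing squares [r^2] and [(r + 1)^2] have indices [r.-1]
   and [r]. *)
have rn : (square r.-1 <= n)%N.
  by rewrite /square prednK// -(ler_nat R) natrX -sE ler_sqr ?nnegrE.
have nr : (n <= square r)%N.
  by rewrite /square -(ler_nat R) natrX -sE ler_sqr ?nnegrE// ltW.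
have rc : 3 * `|c| <= e / 5 * r%:R.
  have : (Num.truncn (3 * `|c| / (e / 5))).+1%:R <= r%:R :> R.
    rewrite ler_nat; apply: rge; near: n; exact: nbhs_infty_ge.
  have /ltW := truncnS_gt (3 * `|c| / (e / 5)).
  by move=> /le_trans /[apply]; rewrite ler_pdivrMr// (mulrC (e / 5)).
have r2 : (2 <= r)%N by apply: rge; near: n; exact: nbhs_infty_ge.
have Jr : (J <= r.-1)%N by rewrite -ltnS prednK.
have h1 := HJ r.-1 Jr; have h2 := HJ r (ltnW rJ).
rewrite /= /square prednK// !natrX in h1; rewrite /= /square natrX -natr1 in h2.
have m1 := mS _ _ rn; have m2 := mS _ _ nr.
rewrite /square prednK// in m1; rewrite /square in m2.
have rn' : r%:R ^+ 2 <= n%:R :> R by rewrite -natrX ler_nat; rewrite /square prednK// in rn.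
have nr' : n%:R <= (r%:R + 1) ^+ 2 :> R by rewrite natr1 -natrX ler_nat.
have r2' : 2 <= r%:R :> R by rewrite ler_nat.
have n0' : 0 < n%:R :> R by rewrite ltr0n.
have -> : c - n%:R^-1 * S n = - (S n - c * n%:R) / n%:R by field; rewrite gt_eqF.
rewrite normrM normrN normfV (ger0_norm (ltW n0')) ler_pdivrMr//.
move: h1 h2 m1 m2 rc; set Sr := S (r ^ 2)%N; set Sr1 := S _.
move: (S n) Sr Sr1 r%:R n%:R rn' nr' r2' n0' => T Sr Sr1 a b ab ba a2 b0.
move=> /ler_normlP[h1 h2] /ler_normlP[h3 h4] m1 m2 rc.
have cge := ler_norm c; have cle := ler_norm (- c); rewrite normrN in cle.
have c0 := normr_ge0 c.
have k1 : `|c| * (2 * a + 1) <= e / 5 * a ^+ 2.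
  apply: (@le_trans _ _ (3 * `|c| * a)); first by nra.
  by rewrite expr2 mulrA ler_wpM2r//; lra.
have k2 : c * ((a + 1) ^+ 2 - b) <= `|c| * (2 * a + 1).
  apply: (@le_trans _ _ (`|c| * ((a + 1) ^+ 2 - b))).
    by rewrite ler_wpM2r// subr_ge0.
  by rewrite ler_wpM2l//; lra.
have k3 : c * (b - a ^+ 2) <= `|c| * (2 * a + 1).
  apply: (@le_trans _ _ (`|c| * (b - a ^+ 2))).
    by rewrite ler_wpM2r// subr_ge0.
  by rewrite ler_wpM2l//; lra.
have k4 : e / 5 * (a + 1) ^+ 2 <= e / 5 * (4 * a ^+ 2).
  by rewrite ler_wpM2l ?(ltW e4)//; nra.
have k5 : e / 5 * a ^+ 2 <= e / 5 * b by rewrite ler_wpM2l ?(ltW e4).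
by apply/ler_normlP; split; lra.
Unshelve. all: by end_near. Qed.

Lemma log_digit_sum_homo y : 0 < y < 1 -> irrational y ->
  {homo log_digit_sum y : m n / (m <= n)%N >-> m <= n}.
Proof.
move=> y01 iy; apply: homo_leq => //; first exact: le_trans.
move=> n; rewrite /log_digit_sum big_ord_recr/= lerDl ln_ge0// ler1n.
exact: cf_digit_gt0.
Qed.

Lemma khinchin_log_mean : {ae @lebesgue_measure R, forall y, 0 < y < 1 -> irrational y ->
  (fun n => n%:R^-1 * log_digit_sum y n) @ \oo --> log_K0_sum R / ln 2}.
Proof.
set c := log_K0_sum R / ln 2.
have e0 m : 0 < m.+1%:R^-1 :> R by [].
(* The null set depends on the tolerance, so the tolerances are restricted to the countable family
   [1 / m.+1]. *)
have := @ae_foralln _ _ _ (@lebesgue_measure R) _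
  (fun m => square_deviation (e0 m) (approx_poisson (e0 m))).
apply: filterS => y Hy y01 iy; apply: cvg_mean_of_squares.
  exact: log_digit_sum_homo.
move=> e e_gt0.
have e3 : 0 < e / 3 by rewrite divr_gt0.
pose m := Num.truncn (e / 3)^-1.
have me : 3 * m.+1%:R^-1 <= e.
  have : m.+1%:R^-1 <= e / 3.
    by rewrite -[leRHS]invrK lef_pV2 ?posrE ?invr_gt0// ltW// truncnS_gt.
  by rewrite ler_pdivlMr// mulrC.
have := Hy m y01 iy; apply: filterS => j; move/le_trans; apply.
by rewrite ler_wpM2r.
Qed.

End khinchin.

(** * Symmetric means *)

Section symmetric_mean.
Variable R : realType.
Local Close Scope classical_set_scope.

(** Pascal's rule: the sets avoiding [i] are the [k.+1]-subsets of its complement, and removing them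
    from all [k.+1]-subsets leaves the count. *)
Lemma card_draws_mem n k (i : 'I_n) :
  #|[set I : {set 'I_n} | (#|I| == k.+1) && (i \in I)]| = 'C(n.-1, k).
Proof.
have n0 : (0 < n)%N by rewrite (leq_ltn_trans _ (ltn_ord i)).
have h1 := cards_draws [set~ i] k.+1.
have h2 := @card_draws 'I_n k.+1.
rewrite cardsC1 !card_ord in h1 h2.
have := cardsID [set I : {set 'I_n} | i \in I] [set I : {set 'I_n} | #|I| == k.+1].
rewrite h2 -[in RHS](prednK n0) binS.
have -> : [set I : {set 'I_n} | #|I| == k.+1] :\: [set I : {set 'I_n} | i \in I] =
   [set A : {set 'I_n} | A \subset [set~ i] & #|A| == k.+1].
  by apply/setP => A; rewrite !inE finset.subsetC finset.sub1set inE.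
rewrite h1 [RHS]addnC => /addIn <-; congr #|pred_of_set _|.
by apply/setP => A; rewrite !inE.
Qed.

Variables (n k : nat) (x : 'I_n -> R).
Hypothesis x1 : forall i, 1 <= x i.

Let x0 i : 0 < x i := lt_le_trans ltr01 (x1 i).

(** Convertible to [S_cf] when [x] lists the digits. *)
Definition symmetric_mean : R :=
  ('C(n, k)%:R)^-1 * \sum_(I : {set 'I_n} | #|I| == k) \prod_(i in I) x i.

Let expR_sum_ln (P : pred 'I_n) :
  \prod_(i | P i) x i = expR (\sum_(i | P i) ln (x i)).
Proof. by rewrite expR_sum; apply: eq_bigr => i _; rewrite lnK// posrE. Qed.

Lemma card_draws_sum (a : R) :
  \sum_(I : {set 'I_n} | #|I| == k) a = 'C(n, k)%:R * a.
Proof.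
rewrite sumr_const mulr_natl; congr (_ *+ _).
by rewrite -[n in 'C(n, _)]card_ord -card_draws; apply: eq_card => I; rewrite !inE.
Qed.

(* Multiplying by the missing digits, all at least [1], only increases a term. *)
Lemma symmetric_mean_le : (k <= n)%N ->
  symmetric_mean <= expR (\sum_(i < n) ln (x i)).
Proof.
move=> kn; have C0 : 0 < 'C(n, k)%:R :> R by rewrite ltr0n bin_gt0.
rewrite /symmetric_mean mulrC ler_pdivrMr// mulrC -card_draws_sum.
apply: ler_sum => I _; rewrite expR_sum_ln ler_expR.
rewrite [leRHS](bigID (mem I))/= lerDl sumr_ge0// => i _.
exact: ln_ge0.
Qed.

(* AM-GM through [1 + y <= expR y]; each index lies in [C(n-1, k-1)] subsets. *)
Lemma symmetric_mean_ge : (0 < k <= n)%N ->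
  expR (k%:R / n%:R * \sum_(i < n) ln (x i)) <= symmetric_mean.
Proof.
case/andP=> k0 kn; have n0 : (0 < n)%N := leq_trans k0 kn.
have C0 : 0 < 'C(n, k)%:R :> R by rewrite ltr0n bin_gt0.
rewrite /symmetric_mean [leRHS]mulrC ler_pdivlMr// mulrC.
set l := \sum_(i < n) ln (x i); set g := k%:R / n%:R * l.
(* Double counting, with [n C(n-1, k-1) = k C(n, k)]: the average of the logarithms of the products
   is [g]. *)
have E : \sum_(I : {set 'I_n} | #|I| == k) \sum_(i in I) ln (x i) = 'C(n, k)%:R * g.
  rewrite (exchange_big_dep xpredT)//=.
  have cnt i : \sum_(I : {set 'I_n} | (#|I| == k) && (i \in I)) ln (x i) =
      'C(n.-1, k.-1)%:R * ln (x i).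
    rewrite sumr_const mulr_natl; congr (_ *+ _).
    by rewrite -(card_draws_mem _ i) prednK//; apply: eq_card => I; rewrite !inE.
  rewrite (eq_bigr _ (fun i _ => cnt i)) -mulr_sumr -/l /g.
  have := mul_bin_diag n k.-1; rewrite prednK// => /(congr1 (fun m => m%:R : R)).
  rewrite !natrM => h.
  have nR : n%:R != 0 :> R by rewrite pnatr_eq0 -lt0n.
  have -> : 'C(n, k)%:R * (k%:R / n%:R * l) = (k%:R * 'C(n, k)%:R) * (l / n%:R) by ring.
  by rewrite -h; field.
(* Each product is compared with the tangent to the exponential at [g]; by [E] the linear terms sum
   to zero. *)
have -> : 'C(n, k)%:R * expR g = \sum_(I : {set 'I_n} | #|I| == k)
    (expR g * (1 + (\sum_(i in I) ln (x i) - g))).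
  rewrite -mulr_sumr big_split/= sumrB E !card_draws_sum; ring.
apply: ler_sum => I _; rewrite expR_sum_ln.
set t := \sum_(i in I) _; have {2}-> : t = g + (t - g) by ring.
by rewrite expRD ler_wpM2l ?expR_ge0// expR_ge1Dx.
Qed.

End symmetric_mean.

(** The partial products are exponentials of partial sums of a convergent series, so the [limn] in
    [khinchin_K0] is a genuine limit. *)
Lemma khinchin_K0E (R : realType) : khinchin_K0 R = expR (log_K0_sum R / ln 2).
Proof.
apply/cvg_lim => //.
have -> : (fun N => \prod_(1 <= r < N.+1)
    ((1 + (r%:R * (r%:R + 2))^-1) `^ (ln (r%:R : R) / ln 2))) =
  (fun N => expR (series (fun k => ln k.+1%:R *
      ln (1 + (k.+1%:R * (k.+1%:R + 2))^-1)) N * (ln 2)^-1)).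
  apply/funext => N; rewrite /series /= mulr_suml expR_sum big_add1 /=.
  apply: eq_bigr => k _; rewrite /powR gt_eqF; first by rewrite mulrAC.
  by rewrite addr_gt0// invr_gt0 mulr_gt0// addr_gt0.
apply: continuous_cvg; first exact: continuous_expR.
by apply: cvgMl; exact: log_K0_sum_cvg.
Qed.

Theorem theorem1p2 (R : realType) (f : nat -> nat)
  (hf_lt : forall n : nat, (0 < n)%N -> (f n < n)%N)
  (hf_o : (fun n : nat => (f n)%:R : R) =o_\oo (fun n : nat => n%:R : R)) :
  {ae (@lebesgue_measure R), forall alpha : R,
     0 < alpha < 1 -> irrational alpha ->
     (fun n : nat => S_cf alpha n (n - f n) `^ ((n - f n)%:R^-1))
       @ \oo --> khinchin_K0 R}.
Proof.
(* Here [f n = o(n)] enters: [1 - (n - f n) / n] equals [f n / n]. *)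
have ratio : (fun n => ((n - f n)%:R / n%:R)^-1 : R) @ \oo --> (1 : R).
  rewrite -[X in _ --> X]invr1; apply: cvgV => //.
  apply/cvgrPdist_le => e e0.
  move/eqoP: hf_o => /(_ e e0); apply: filter_app; near=> n.
  have n0 : (0 < n)%N by near: n; exact: nbhs_infty_gt.
  have nR : 0 < n%:R :> R by rewrite ltr0n.
  rewrite /= !normr_nat natrB ?(ltnW (hf_lt n n0))// => h.
  have -> : 1 - (n%:R - (f n)%:R) / n%:R = (f n)%:R / n%:R :> R by field; rewrite gt_eqF.
  by rewrite ger0_norm// ler_pdivrMr.
apply: negligibleS (khinchin_log_mean R); apply: subsetC => y Hy y01 iy.
have lim1 := Hy y01 iy; set c := _ / _ in lim1.
rewrite khinchin_K0E -/c.
have lim2 : (fun n => ((n - f n)%:R / n%:R)^-1 * (n%:R^-1 * log_digit_sum y n)) @ \oo --> c.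
  by rewrite -[X in _ --> X]mul1r; apply: cvgM.
have digit1 n (i : 'I_n) : 1 <= (cf_digit i.+1 y)%:R :> R by rewrite ler1n cf_digit_gt0.
(* Taking logarithms is legitimate for [n > 0], where [S_cf] is positive. *)
suff lim3 : (fun n => (n - f n)%:R^-1 * ln (S_cf y n (n - f n))) @ \oo --> c.
  apply: cvg_trans (continuous_cvg _ (@continuous_expR R c) lim3).
  apply: near_eq_cvg; near=> n.
  have n0 : (0 < n)%N by near: n; exact: nbhs_infty_gt.
  have kn : (0 < n - f n <= n)%N by rewrite subn_gt0 hf_lt// leq_subr.
  rewrite /powR gt_eqF//.
  exact: lt_le_trans (expR_gt0 _) (symmetric_mean_ge (digit1 n) kn).
(* With [k = n - f n] and [l] the sum of the logarithms, dividing the logarithms of both bounds by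
   [k] gives [l / n] below and [l / k = (n / k) (l / n)] above. *)
apply: squeeze_cvgr lim1 lim2; near=> n.
have n0 : (0 < n)%N by near: n; exact: nbhs_infty_gt.
have kn : (0 < n - f n <= n)%N by rewrite subn_gt0 hf_lt// leq_subr.
have lo := symmetric_mean_ge (digit1 n) kn.
have hi := symmetric_mean_le (digit1 n) (leq_subr (f n) n).
have S0 := lt_le_trans (expR_gt0 _) lo.
have nR : 0 < n%:R :> R by rewrite ltr0n.
have kR : 0 < (n - f n)%:R :> R by rewrite ltr0n; case/andP: kn.
move: lo hi; rewrite -[symmetric_mean _ _]/(S_cf y n (n - f n)) in S0 *.
rewrite -{1}[S_cf _ _ _]lnK// ler_expR -[S_cf _ _ _ in X in _ -> X -> _]lnK// ler_expR.
rewrite -/(log_digit_sum y n) => lo hi; apply/andP; split.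
  by rewrite ler_pdivlMl// mulrA.
have -> : ((n - f n)%:R / n%:R)^-1 * (n%:R^-1 * log_digit_sum y n) =
  (n - f n)%:R^-1 * log_digit_sum y n by field; rewrite !gt_eqF.
by rewrite ler_wpM2l// invr_ge0 ltW.
Unshelve. all: by end_near. Qed.
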